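(* Let $\mathscr{A}$ be a $C^*$-algebra, $\mathscr{X}$ a Hilbert $\mathscr{A}$-module and $x,y\in\mathscr{X}$. The following are equivalent: (i) $x\perp_B y$, i.e. $\|x\|\le\|x+\lambda y\|$ for all $\lambda\in\mathbb{C}$; (ii) there exists $\varphi\in\Omega_x$ such that $\varphi(\langle x,y\rangle)=0$; (iii) $\|x+\lambda y\|^2\ge\|x\|^2+|\lambda|^2 m(y)$ for all $\lambda\in\mathbb{C}$, where $m(y):=\inf\{\varphi(\langle y,y\rangle):\varphi\in\mathcal{S}(\mathscr{A})\}$.
   Context: A Hilbert $\mathscr{A}$-module is a right $\mathscr{A}$-module $\mathscr{X}$ with an $\mathscr{A}$-valued inner product $\langle\cdot,\cdot\rangle$, linear in the second variable and conjugate-linear in the first, with $\langle x,ya\rangle=\langle x,y\rangle a$, $\langle x,y\rangle^*=\langle y,x\rangle$, $\langle x,x\rangle\ge 0$ with equality iff $x=0$, complete for the norm $\|x\|=\|\langle x,x\rangle\|^{1/2}$. A state on $\mathscr{A}$ is a positive linear functional of norm one; $\mathcal{S}(\mathscr{A})$ denotes the set of states. For $x\in\mathscr{X}$, $\Omega_x:=\{\varphi\in\mathcal{S}(\mathscr{A}):\varphi(\langle x,x\rangle)=\|x\|^2\}$. *)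

(* Defs.v *)
From HB Require Import structures.
From mathcomp Require Import all_boot all_order all_algebra.
From mathcomp Require Import complex.
From mathcomp Require Import classical_sets reals.
Set Implicit Arguments. Unset Strict Implicit. Unset Printing Implicit Defensive.
Import Order.TTheory GRing.Theory Num.Theory.
Local Open Scope ring_scope.

Definition cauchy_seq (R : realType) (V : zmodType) (nrm : V -> R) (u : nat -> V) :=
  forall eps : R, 0 < eps -> exists N : nat, forall m n : nat,
    (N <= m)%N -> (N <= n)%N -> nrm (u m - u n) < eps.
Definition converges_to (R : realType) (V : zmodType) (nrm : V -> R) (u : nat -> V) (l : V) :=
  forall eps : R, 0 < eps -> exists N : nat, forall n : nat,
    (N <= n)%N -> nrm (u n - l) < eps.

Record cstar_algebra (R : realType) := CstarAlgebra {
  ca_carrier :> lmodType R[i];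
  ca_mul : ca_carrier -> ca_carrier -> ca_carrier;
  ca_star : ca_carrier -> ca_carrier;
  ca_norm : ca_carrier -> R;
  ca_mulA : forall a b c, ca_mul a (ca_mul b c) = ca_mul (ca_mul a b) c;
  ca_mulDl : forall a b c, ca_mul (a + b) c = ca_mul a c + ca_mul b c;
  ca_mulDr : forall a b c, ca_mul a (b + c) = ca_mul a b + ca_mul a c;
  ca_mulZl : forall (k : R[i]) a b, ca_mul (k *: a) b = k *: ca_mul a b;
  ca_mulZr : forall (k : R[i]) a b, ca_mul a (k *: b) = k *: ca_mul a b;
  ca_starD : forall a b, ca_star (a + b) = ca_star a + ca_star b;
  ca_starZ : forall (k : R[i]) a, ca_star (k *: a) = (Num.conj k) *: ca_star a;
  ca_starK : forall a, ca_star (ca_star a) = a;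
  ca_starM : forall a b, ca_star (ca_mul a b) = ca_mul (ca_star b) (ca_star a);
  ca_norm_eq0 : forall a, ca_norm a = 0 -> a = 0;
  ca_normD : forall a b, ca_norm (a + b) <= ca_norm a + ca_norm b;
  ca_normZ : forall (k : R[i]) a, ca_norm (k *: a) = Normc.normc k * ca_norm a;
  ca_normM : forall a b, ca_norm (ca_mul a b) <= ca_norm a * ca_norm b;
  ca_cstar : forall a, ca_norm (ca_mul (ca_star a) a) = ca_norm a ^+ 2;
  ca_complete : forall u : nat -> ca_carrier, cauchy_seq ca_norm u ->
    exists l, converges_to ca_norm u l
}.

Definition ca_pos (R : realType) (A : cstar_algebra R) (a : A) : Prop :=
  exists b : A, a = ca_mul (ca_star b) b.

Definition is_state (R : realType) (A : cstar_algebra R) (phi : A -> R[i]) : Prop :=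
  [/\ (forall (k : R[i]) (a b : A), phi (k *: a + b) = k * phi a + phi b),
      (forall a : A, ca_pos a -> 0 <= phi a),
      (forall a : A, Normc.normc (phi a) <= ca_norm a) &
      (forall eps : R, 0 < eps ->
         exists a : A, ca_norm a <= 1 /\ 1 - eps < Normc.normc (phi a))].

Record hilbert_module (R : realType) (A : cstar_algebra R) := HilbertModule {
  hm_carrier :> lmodType R[i];
  hm_act : hm_carrier -> A -> hm_carrier;
  hm_ip : hm_carrier -> hm_carrier -> A;
  hm_actDl : forall x y a, hm_act (x + y) a = hm_act x a + hm_act y a;
  hm_actDr : forall x a b, hm_act x (a + b) = hm_act x a + hm_act x b;
  hm_actM : forall x a b, hm_act x (ca_mul a b) = hm_act (hm_act x a) b;
  hm_actZl : forall (k : R[i]) x a, hm_act (k *: x) a = k *: hm_act x a;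
  hm_actZr : forall (k : R[i]) x a, hm_act x (k *: a) = k *: hm_act x a;
  hm_ip_lin : forall (k : R[i]) x y z, hm_ip x (k *: y + z) = k *: hm_ip x y + hm_ip x z;
  hm_ip_act : forall x y a, hm_ip x (hm_act y a) = ca_mul (hm_ip x y) a;
  hm_ip_star : forall x y, ca_star (hm_ip x y) = hm_ip y x;
  hm_ip_pos : forall x, ca_pos (hm_ip x x);
  hm_ip_eq0 : forall x, hm_ip x x = 0 -> x = 0;
  hm_complete : forall u : nat -> hm_carrier,
    cauchy_seq (fun x => Num.sqrt (ca_norm (hm_ip x x))) u ->
    exists l, converges_to (fun x => Num.sqrt (ca_norm (hm_ip x x))) u l
}.

Definition hm_norm (R : realType) (A : cstar_algebra R) (X : hilbert_module A) (x : X) : R :=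
  Num.sqrt (ca_norm (hm_ip x x)).

Definition Omega (R : realType) (A : cstar_algebra R) (X : hilbert_module A) (x : X) :
  (A -> R[i]) -> Prop :=
  fun phi => is_state phi /\ phi (hm_ip x x) = (((hm_norm x) ^+ 2)%:C)%C.

Definition birkhoff_orth (R : realType) (A : cstar_algebra R) (X : hilbert_module A) (x y : X) :=
  forall lam : R[i], hm_norm x <= hm_norm (x + lam *: y).

(* m(y) = inf { phi(<y,y>) : phi state } ; phi(<y,y>) is real nonnegative, we take Re *)
Definition mval (R : realType) (A : cstar_algebra R) (X : hilbert_module A) (y : X) : R :=
  inf [set complex.Re (phi (hm_ip y y)) | phi in @is_state R A]%classic.

(* Main.v *)
Require Import Defs.
From HB Require Import structures.
From mathcomp Require Import all_boot all_order all_algebra complex.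
From mathcomp Require Import boolp classical_sets reals.
From mathcomp Require Import ring lra.
Set Implicit Arguments. Unset Strict Implicit. Unset Printing Implicit Defensive.
Import Order.TTheory GRing.Theory Num.Theory.
Local Open Scope ring_scope.

(* The only non-formal implication is (i) => (ii).  Put c = <x,x>, b = <x,y>.
   Expanding <x + lam y, x + lam y> and using convexity of the norm, x _|_B y
   gives |c| <= |c + lam b| for all lam, and Hahn-Banach then yields a
   functional f <= |.| with f(c) = |c| and f(lam b) = 0, on the unitization of
   A.  It remains to see that a contractive functional attaining its norm at a
   square c = v^* v is positive.  For this, squares v^* v are positive in the
   sense that u = u^* and |t - u| <= t for some t (Kaplansky's argument, with
   square roots built by iteration rather than by functional calculus), so
   that |1 - c| <= 1 and |1 - 2c| <= 1 for normalized squares c. *)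

(** The return implications cost little: a state killing <x,y>, applied to the expansion of <x + lam
    y, x + lam y>, gives (iii), and m(y) >= 0 gives (i). The obstacle in (i) => (ii) is that the
    extension theorem controls norms only, while a state must be positive, and A may have no unit to
    compare with. Hence the unitization, and a notion of positivity phrased by norm balls, which a
    contractive functional can test directly. The functional f is only real-linear; it is shown to
    vanish on i times self-adjoint elements, and is complexified at the very end as f(a) - i f(ia).
    Nontriviality of A supplies a state when x = 0: the zero algebra has none, although 0 is
    orthogonal to itself. *)

Section ComplexModulus.
Variable R : realType.
Implicit Types (x : R) (k : R[i]).
Local Notation normc := (@Normc.normc R).

Lemma normc_ge0 k : 0 <= normc k.
Proof. by case: k => a b; exact: sqrtr_ge0. Qed.

Lemma normcR x : normc (x%:C)%C = `|x|.
Proof. by rewrite /= expr0n /= addr0 sqrtr_sqr. Qed.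

Lemma normcR_ge0 x : 0 <= x -> normc (x%:C)%C = x.
Proof. by move=> x0; rewrite normcR ger0_norm. Qed.

Lemma conjRe x : Num.conj ((x%:C)%C : R[i]) = (x%:C)%C.
Proof. exact: conjc_real. Qed.

Lemma normc_i : normc 'i%C = 1.
Proof. by rewrite /= expr0n expr1n /= add0r sqrtr1. Qed.

Lemma conj_i : Num.conj ('i%C : R[i]) = - 'i%C.
Proof. by apply/eqP; rewrite eq_complex /= oppr0 !eqxx. Qed.

Lemma normc_conj k : normc (Num.conj k) = normc k.
Proof. by case: k => a b; rewrite /= sqrrN. Qed.

Lemma normcN k : normc (- k) = normc k.
Proof. by case: k => a b; rewrite /= !sqrrN. Qed.

Lemma normcD k l : normc (k + l) <= normc k + normc l.
Proof. by have := ler_normD k l; rewrite -lecR rmorphD. Qed.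

Lemma normc_half : normc 2^-1 = 2^-1.
Proof.
rewrite Normc.normcV; congr (_^-1).
by rewrite -(rmorph_nat (real_complex R)) normcR_ge0.
Qed.

Lemma ler_normc_Re k : complex.Re k <= normc k.
Proof.
case: k => a b /=; apply: le_trans (ler_norm _) _.
by rewrite -sqrtr_sqr ler_wsqrtr // lerDl sqr_ge0.
Qed.

End ComplexModulus.

Lemma half_double (R : realType) (V : lmodType R[i]) (a : V) :
  2^-1 *: (a + a) = a.
Proof.
by rewrite -mulr2n -[a *+ 2]scaler_nat scalerA mulVf ?scale1r ?pnatr_eq0.
Qed.

Record unital_cstar (R : realType) := UnitalCstar {
  uc_carrier :> algType R[i];
  uc_star : uc_carrier -> uc_carrier;
  uc_norm : uc_carrier -> R;
  uc_starD : forall a b, uc_star (a + b) = uc_star a + uc_star b;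
  uc_starZ : forall (k : R[i]) a, uc_star (k *: a) = (Num.conj k) *: uc_star a;
  uc_starK : forall a, uc_star (uc_star a) = a;
  uc_starM : forall a b, uc_star (a * b) = uc_star b * uc_star a;
  uc_norm_eq0 : forall a, uc_norm a = 0 -> a = 0;
  uc_normD : forall a b, uc_norm (a + b) <= uc_norm a + uc_norm b;
  uc_normZ : forall (k : R[i]) a, uc_norm (k *: a) = Normc.normc k * uc_norm a;
  uc_normM : forall a b, uc_norm (a * b) <= uc_norm a * uc_norm b;
  uc_cstar : forall a, uc_norm (uc_star a * a) = uc_norm a ^+ 2;
  uc_complete : forall u : nat -> uc_carrier, cauchy_seq uc_norm u ->
    exists l, converges_to uc_norm u l
}.

(** * Norm identities in a unital C*-algebra and the square root of 1 - w *)

Section UnitalCstarTheory.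
Variables (R : realType) (B : unital_cstar R).
Implicit Types (a b u v w x y z : B) (t : R).
Local Notation star := (@uc_star R B).
Local Notation N := (@uc_norm R B).

Lemma uc_star0 : star 0 = 0.
Proof. by rewrite -[X in star X](scale0r (0 : B)) uc_starZ rmorph0 scale0r. Qed.

Lemma uc_starN a : star (- a) = - star a.
Proof. by rewrite -scaleN1r uc_starZ rmorphN1 scaleN1r. Qed.

Lemma uc_starB a b : star (a - b) = star a - star b.
Proof. by rewrite uc_starD uc_starN. Qed.

Lemma uc_star1 : star 1 = 1.
Proof. by have := uc_starM (star 1) 1; rewrite uc_starK !mulr1 uc_starK. Qed.

Lemma uc_starR t a : star ((t%:C)%C *: a) = (t%:C)%C *: star a.
Proof. by rewrite uc_starZ conjRe. Qed.

Lemma uc_star_i a : star ('i%C *: a) = - ('i%C *: star a).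
Proof. by rewrite uc_starZ conj_i scaleNr. Qed.

Lemma uc_norm0 : N 0 = 0.
Proof. by rewrite -(scale0r (0 : B)) uc_normZ Normc.normc0 mul0r. Qed.

Lemma uc_normN a : N (- a) = N a.
Proof. by rewrite -scaleN1r uc_normZ normcN Normc.normc1 mul1r. Qed.

Lemma uc_normBC a b : N (a - b) = N (b - a).
Proof. by rewrite -uc_normN opprB. Qed.

Lemma uc_norm_tri a b c : N (a - c) <= N (a - b) + N (b - c).
Proof. by apply: le_trans (uc_normD _ _); rewrite addrA subrK. Qed.

Lemma uc_norm_ge0 a : 0 <= N a.
Proof.
have := uc_normD a (- a); rewrite subrr uc_norm0 uc_normN.
by rewrite -mulr2n pmulrn_lge0.
Qed.

Lemma uc_norm_scale t a : 0 <= t -> N ((t%:C)%C *: a) = t * N a.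
Proof. by move=> t0; rewrite uc_normZ normcR_ge0. Qed.

Lemma uc_norm_half a : N (2^-1 *: a) = 2^-1 * N a.
Proof. by rewrite uc_normZ normc_half. Qed.

Lemma uc_norm_i a : N ('i%C *: a) = N a.
Proof. by rewrite uc_normZ normc_i mul1r. Qed.

Lemma uc_norm_star a : N (star a) = N a.
Proof.
suff le b : N b <= N (star b).
  by apply/eqP; rewrite eq_le le andbT -{2}[a]uc_starK le.
have [/eqP b0|b0] := boolP (N b == 0); first by rewrite b0 uc_norm_ge0.
have bp : 0 < N b by rewrite lt_neqAle eq_sym b0 uc_norm_ge0.
by rewrite -(ler_pM2r bp) -expr2 -uc_cstar uc_normM.
Qed.

Lemma uc_norm1 : N 1 = 1.
Proof.
have n1 : N 1 != 0.
  by apply/eqP => /uc_norm_eq0/eqP; rewrite oner_eq0.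
by apply: (mulfI n1); rewrite -expr2 -uc_cstar uc_star1 !mulr1.
Qed.

Lemma uc_norm_sa a : star a = a -> N (a * a) = N a ^+ 2.
Proof. by move=> sa; rewrite -uc_cstar sa. Qed.

Lemma uc_sa_sqr_eq0 a : star a = a -> a * a = 0 -> a = 0.
Proof.
move=> sa a2; apply: uc_norm_eq0; apply/eqP.
by rewrite -sqrf_eq0 -uc_norm_sa // a2 uc_norm0.
Qed.

Lemma uc_star_mul_sa a : star (star a * a) = star a * a.
Proof. by rewrite uc_starM uc_starK. Qed.

(** Serves to pass algebraic identities to limits of sequences. No sign is imposed on [K], whence
    the division by |K| + 1 in the proof. *)
Lemma uc_eq_small a b (K : R) :
  (forall eps : R, 0 < eps -> N (a - b) <= K * eps) -> a = b.
Proof.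
move=> small; apply/eqP; rewrite -subr_eq0; apply/eqP/uc_norm_eq0/eqP.
rewrite eq_le uc_norm_ge0 andbT; apply/ler_addgt0Pr => e e0; rewrite add0r.
have K0 : 0 < `|K| + 1 by rewrite ltr_wpDl.
apply: le_trans (small (e / (`|K| + 1)) _) _; first by rewrite divr_gt0.
rewrite mulrCA ger_pMr // ler_pdivrMr // mul1r.
by rewrite (le_trans (ler_norm K)) // lerDl.
Qed.

(** With x = u + iv, both u and iv are half of x plus or minus its adjoint, and the adjoint has the
    same norm as x. *)
Lemma uc_norm_cart u v : star u = u -> star v = v ->
  N u <= N (u + 'i%C *: v) /\ N v <= N (u + 'i%C *: v).
Proof.
move=> su sv; set x := u + _.
have sx : star x = u - 'i%C *: v by rewrite uc_starD uc_star_i su sv.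
have ux : u = 2^-1 *: (x + star x).
  by rewrite sx /x addrACA subrr addr0 half_double.
have vx : 'i%C *: v = 2^-1 *: (x - star x).
  by rewrite sx /x opprB addrC addrA subrK half_double.
have half_le y : N y <= N x + N x -> N (2^-1 *: y) <= N x.
  by rewrite uc_norm_half => h; lra.
split; first by rewrite ux; apply: half_le; have := uc_normD x (star x);
  rewrite uc_norm_star.
rewrite -uc_norm_i vx; apply: half_le; apply: le_trans (uc_normD _ _) _.
by rewrite uc_normN uc_norm_star.
Qed.

(** A fixed point y of t -> (w + t^2)/2 satisfies (1 - y)^2 = 1 - w. The scalar sequence is the case
    w = 1; it dominates the other one, increments included, whenever |w| <= 1. *)
Let sq_maj n : R := iter n (fun t => 2^-1 * (1 + t * t)) 0.
Let sq_seq w n : B := iter n (fun y => 2^-1 *: (w + y * y)) 0.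

Let sq_maj_itv n : 0 <= sq_maj n <= 1.
Proof.
elim: n => [|n] /=; first by rewrite lexx ler01.
by rewrite -/(sq_maj n) => /andP[h0 h1]; apply/andP; split; nra.
Qed.

Let sq_majS n : sq_maj n <= sq_maj n.+1.
Proof.
rewrite /= -/(sq_maj n).
have := sqr_ge0 (1 - sq_maj n); rewrite expr2 => h; lra.
Qed.

Let sq_maj_homo m n : (m <= n)%N -> sq_maj m <= sq_maj n.
Proof. exact: (homo_leq (r := <=%R) (@lexx _ R) (@le_trans _ R) sq_majS). Qed.

Let sq_seq_norm w n : N w <= 1 -> N (sq_seq w n) <= sq_maj n.
Proof.
move=> w1; elim: n => [|n IH] /=; first by rewrite uc_norm0.
rewrite -/(sq_seq w n) -/(sq_maj n) uc_norm_half ler_pM2l ?invr_gt0 //.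
apply: le_trans (uc_normD _ _) _; apply: lerD => //.
by apply: le_trans (uc_normM _ _) _; apply: ler_pM; rewrite ?uc_norm_ge0.
Qed.

(** The splitting y'^2 - y^2 = (y' - y) y' + y (y' - y) needs no commutation, and the same splitting
    of the scalar increments bounds it term by term. *)
Let sq_seq_stepS w n : N w <= 1 ->
  N (sq_seq w n.+1 - sq_seq w n) <= sq_maj n.+1 - sq_maj n.
Proof.
move=> w1; elim: n => [|n IH].
  rewrite /= !subr0 !mulr0 !addr0 uc_norm_half.
  by rewrite ler_pM2l ?invr_gt0.
set y := sq_seq w n in IH *; set y' := sq_seq w n.+1 in IH *.
set s := sq_maj n in IH *; set s' := sq_maj n.+1 in IH *.
have -> : sq_seq w n.+2 - y' = 2^-1 *: ((y' - y) * y' + y * (y' - y)).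
  transitivity (2^-1 *: (w + y' * y') - 2^-1 *: (w + y * y)); first by [].
  rewrite -scalerBr; congr (_ *: _).
  by rewrite mulrBl mulrBr addrA subrK opprD addrACA subrr add0r.
have -> : sq_maj n.+2 - s' = 2^-1 * ((s' - s) * s' + s * (s' - s)).
  transitivity (2^-1 * (1 + s' * s') - 2^-1 * (1 + s * s)); first by [].
  by ring.
rewrite uc_norm_half ler_pM2l ?invr_gt0 //.
apply: le_trans (uc_normD _ _) _.
by apply: lerD; apply: le_trans (uc_normM _ _) _;
  apply: ler_pM; rewrite ?uc_norm_ge0 ?sq_seq_norm.
Qed.

Let sq_seq_step w m n : N w <= 1 -> (m <= n)%N ->
  N (sq_seq w n - sq_seq w m) <= sq_maj n - sq_maj m.
Proof.
move=> w1; elim: n => [|n IH]; first by rewrite leqn0 => /eqP ->; rewrite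
  !subrr uc_norm0.
rewrite leq_eqVlt => /predU1P[->|]; first by rewrite !subrr uc_norm0.
rewrite ltnS => /IH h; apply: le_trans (uc_norm_tri _ (sq_seq w n) _) _.
by rewrite -(subrK (sq_maj n) (sq_maj n.+1)) -addrA lerD // sq_seq_stepS.
Qed.

Let sq_seq_cauchy w : N w <= 1 -> cauchy_seq N (sq_seq w).
Proof.
(* At |w| = 1 the iteration need not contract geometrically, so the tails are controlled by the
   supremum of the bounded increasing majorant. *)
move=> w1 eps e0; pose E := [set sq_maj n | n in setT]%classic.
have Esup : has_sup E.
  split; first by exists (sq_maj 0), 0%N.
  by exists 1 => _ [n _ <-]; case/andP: (sq_maj_itv n).
have [_ [n0 _ <-] hn0] := sup_adherent e0 Esup; exists n0.
suff wlog m n : (n0 <= m)%N -> (m <= n)%N -> N (sq_seq w n - sq_seq w m) < eps.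
  move=> m n hm hn; have [mn|/ltnW nm] := leqP m n; last exact: wlog.
  by rewrite uc_normBC wlog.
move=> hm hmn; apply: le_lt_trans (sq_seq_step w1 hmn) _.
have := sup_upper_bound Esup (ex_intro2 _ _ n I erefl).
by have := sq_maj_homo hm; lra.
Qed.

(* s = 1 - y, where y is the limit of the iteration y <- (w + y^2)/2. *)
Lemma uc_sqrt_one_sub w : N w <= 1 -> exists s,
  [/\ s * s = 1 - w, N (1 - s) <= 1,
      star w = w -> star s = s & forall z, z * w = w * z -> z * s = s * z].
Proof.
move=> w1; have [l hl] := uc_complete (sq_seq_cauchy w1).
have y1 n : N (sq_seq w n) <= 1.
  by apply: le_trans (sq_seq_norm _ w1) _; case/andP: (sq_maj_itv n).
have l1 : N l <= 1.
  apply/ler_addgt0Pr => e /hl[n /(_ n (leqnn n))]; rewrite uc_normBC => hn.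
  rewrite -(subrK (sq_seq w n) l); apply: le_trans (uc_normD _ _) _.
  by have := y1 n; lra.
have lE : l = 2^-1 *: (w + l * l).
  (* One [e] comes from the distance of the next iterate to [l], the other from the quadratic term,
     where the factor 1/2 meets |y|, |l| <= 1. *)
  apply: (@uc_eq_small _ _ 2) => e e0; have [n hn] := hl e e0.
  set y := sq_seq w n in hn *.
  have hy : N (y - l) < e by apply: hn.
  have hy1 : N y <= 1 by exact: y1.
  have hy' : N (sq_seq w n.+1 - l) < e by apply: hn.
  apply: le_trans (uc_norm_tri _ (sq_seq w n.+1) _) _.
  rewrite mulr_natl mulr2n uc_normBC; apply: lerD; first exact: ltW.
  rewrite -[sq_seq w n.+1]/(2^-1 *: (w + y * y)) -scalerBr opprD addrACA subrr.
  have -> : y * y - l * l = (y - l) * y + l * (y - l).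
    by rewrite mulrBl mulrBr addrA subrK.
  rewrite add0r uc_norm_half.
  have h1 : N ((y - l) * y) <= e * 1.
    by apply: le_trans (uc_normM _ _) _; apply: ler_pM; rewrite ?uc_norm_ge0
      ?(ltW hy).
  have h2 : N (l * (y - l)) <= 1 * e.
    by apply: le_trans (uc_normM _ _) _; apply: ler_pM; rewrite ?uc_norm_ge0
      ?(ltW hy).
  by have := uc_normD ((y - l) * y) (l * (y - l)); lra.
exists (1 - l); split.
- have ll : l + l = w + l * l.
    by rewrite {1 2}lE -scalerDr half_double.
  rewrite mulrBl mul1r mulrBr mulr1 -addrA -opprD; congr (1 - _).
  by rewrite addrA ll addrK.
- by rewrite subKr.
- move=> sw; rewrite uc_starB uc_star1; congr (1 - _).
  have sy n : star (sq_seq w n) = sq_seq w n.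
    elim: n => [|n IH]; first exact: uc_star0.
    rewrite /= -/(sq_seq w n) uc_starZ uc_starD sw uc_starM IH; congr (_ *: _).
    by rewrite fmorphV rmorph_nat.
  apply: (@uc_eq_small _ _ 2) => e e0; have [n /(_ n (leqnn n)) hn] := hl e e0.
  have h : N (star l - sq_seq w n) < e.
    by rewrite -sy -uc_starB uc_norm_star uc_normBC.
  by apply: le_trans (uc_norm_tri _ (sq_seq w n) _) _; lra.
- move=> z zw; rewrite mulrBr mulrBl mulr1 mul1r; congr (_ - _).
  have zy n : z * sq_seq w n = sq_seq w n * z.
    elim: n => [|n IH]; first by rewrite mulr0 mul0r.
    rewrite /= -/(sq_seq w n) -scalerAr -scalerAl mulrDl mulrDr zw.
    by rewrite mulrA IH -mulrA IH mulrA.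
  apply: (@uc_eq_small _ _ (2 * N z)) => e e0.
  have [n /(_ n (leqnn n)) hn] := hl e e0.
  have -> : z * l - l * z = (sq_seq w n - l) * z - z * (sq_seq w n - l).
    by rewrite mulrBl mulrBr zy opprB [RHS]addrC addrA subrK.
  apply: le_trans (uc_normD _ _) _; rewrite uc_normN.
  have hz := uc_norm_ge0 z.
  have h1 : N (sq_seq w n - l) * N z <= e * N z by rewrite ler_wpM2r // ltW.
  have := uc_normM (sq_seq w n - l) z; have := uc_normM z (sq_seq w n - l).
  by rewrite [N z * _]mulrC; lra.
Qed.

End UnitalCstarTheory.

(** * Positivity defined by norm balls *)

Section UnitalCstarOrder.
Variables (R : realType) (B : unital_cstar R).
Implicit Types (a b u v w x y z : B) (t : R).
Local Notation star := (@uc_star R B).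
Local Notation N := (@uc_norm R B).
Local Notation "t %:B" := ((t%:C)%C *: (1 : B)) (at level 2, format "t %:B").

(** For self-adjoint u this says that the spectrum lies in [0, 2t], without mentioning spectra.
    Stability under sums becomes the triangle inequality. *)
Definition uc_pos u := star u = u /\ exists2 t, 0 <= t & N (t%:B - u) <= t.

Lemma uc_posZ t u : 0 <= t -> uc_pos u -> uc_pos ((t%:C)%C *: u).
Proof.
move=> t0 [su [r r0 hr]]; split; first by rewrite uc_starR su.
exists (t * r); first exact: mulr_ge0.
by rewrite rmorphM -scalerA -scalerBr uc_norm_scale // ler_wpM2l.
Qed.

Lemma uc_posD u v : uc_pos u -> uc_pos v -> uc_pos (u + v).
Proof.
move=> [su [r r0 hr]] [sv [r' r0' hr']]; split; first by rewrite uc_starD su sv.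
exists (r + r'); first exact: addr_ge0.
rewrite rmorphD scalerDl opprD addrACA.
by apply: le_trans (uc_normD _ _) _; exact: lerD.
Qed.

(** The C*-identity for the normal element u + iv: the cross terms of (u - iv)(u + iv) cancel. *)
Lemma uc_norm_normal u v : star u = u -> star v = v -> u * v = v * u ->
  N (u + 'i%C *: v) ^+ 2 = N (u * u + v * v).
Proof.
move=> su sv uv; rewrite -uc_cstar uc_starD uc_star_i su sv; congr N.
have ii : 'i%C * 'i%C = - 1 :> R[i] by rewrite -expr2 sqr_i.
rewrite mulrDr !mulrBl -!scalerAl -!scalerAr scalerA ii scaleN1r uv opprK.
by rewrite addrA subrK.
Qed.

(** With s a square root of 1 - v^2 commuting with v, the element v + is has norm 1; hence its
    imaginary part s has norm at most 1, and so has s^2. *)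
Lemma uc_norm_one_sub_sqr v : star v = v -> N v <= 1 -> N (1 - v * v) <= 1.
Proof.
move=> sv v1; have v2 : N (v * v) <= 1 by rewrite uc_norm_sa // expr_le1
  ?uc_norm_ge0.
have [s [s2 _ ss sc]] := uc_sqrt_one_sub v2.
have {}ss : star s = s by apply: ss; rewrite uc_starM sv.
have vs : v * s = s * v by apply: sc; rewrite mulrA.
rewrite -s2 uc_norm_sa // expr_le1 ?uc_norm_ge0 //.
have [_ /le_trans] := uc_norm_cart sv ss; apply.
by rewrite -(@expr_le1 _ 2) ?uc_norm_ge0 // uc_norm_normal // s2 addrC subrK
  uc_norm1.
Qed.

Lemma uc_normalize x : x != 0 -> exists t y,
  [/\ 0 < t, x = (t%:C)%C *: y, N y = 1 & star x = x -> star y = y].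
Proof.
move=> x0; have Nx : 0 < N x.
  rewrite lt_neqAle uc_norm_ge0 eq_sym andbT; apply: contra x0.
  by move=> /eqP/uc_norm_eq0/eqP.
exists (N x), (((N x)^-1%:C)%C *: x); split=> //.
- by rewrite scalerA -rmorphM mulfV ?rmorph1 ?scale1r // gt_eqF.
- by rewrite uc_norm_scale ?mulVf ?gt_eqF // invr_ge0 ltW.
- by move=> sx; rewrite uc_starR sx.
Qed.

Lemma uc_pos0 : uc_pos 0.
Proof. by split; [exact: uc_star0|exists 0; rewrite // scale0r subrr uc_norm0].
  Qed.

Lemma uc_pos_sqr v : star v = v -> uc_pos (v * v).
Proof.
have [->|v0] := eqVneq v 0; first by rewrite mulr0 => _; exact: uc_pos0.
have [t [y [t0 -> y1 /[apply] sy]]] := uc_normalize v0.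
rewrite -scalerAl -scalerAr scalerA -rmorphM; apply: uc_posZ.
  by rewrite mulr_ge0 // ltW.
split; first by rewrite uc_starM sy.
by exists 1 => //; rewrite scale1r uc_norm_one_sub_sqr // y1.
Qed.

(** The ball condition says exactly that u = t (1 - w) with |w| <= 1, so sqrt(t) times the root of 1
    - w works. The bound |1 - s| <= 1 provided by [uc_sqrt_one_sub] makes this root positive in
    turn. *)
Lemma uc_pos_sqrt u : uc_pos u -> exists s,
  [/\ uc_pos s, s * s = u & forall z, z * u = u * z -> z * s = s * z].
Proof.
move=> [su [t]]; rewrite le_eqVlt => /predU1P[<-|t0 ht].
  rewrite scale0r sub0r uc_normN => u0; exists 0.
  have -> : u = 0 by apply: uc_norm_eq0; apply/eqP; rewrite eq_le u0
    uc_norm_ge0.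
  by split=> [||z]; rewrite ?mulr0 ?mul0r //; exact: uc_pos0.
have tn0 : t != 0 by rewrite gt_eqF.
pose w := 1 - ((t^-1)%:C)%C *: u.
have w1 : N w <= 1.
  rewrite -(ler_pM2l t0) mulr1 -uc_norm_scale ?(ltW t0) // scalerBr scalerA
    -rmorphM.
  by rewrite mulfV // rmorph1 scale1r.
have [s [s2 s1 ss sc]] := uc_sqrt_one_sub w1.
have {}ss : star s = s by apply: ss; rewrite uc_starB uc_star1 uc_starR su.
have r0 : 0 <= Num.sqrt t by exact: sqrtr_ge0.
exists (((Num.sqrt t)%:C)%C *: s); split.
- split; first by rewrite uc_starR ss.
  by exists (Num.sqrt t) => //; rewrite -scalerBr uc_norm_scale // ler_piMr.
- rewrite -scalerAl -scalerAr scalerA -rmorphM -expr2 sqr_sqrtr ?ltW // s2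
  subKr.
  by rewrite scalerA -rmorphM mulfV // rmorph1 scale1r.
- move=> z zu; rewrite -scalerAl -scalerAr sc // /w mulrBr mulrBl mulr1 mul1r.
  by rewrite -scalerAl -scalerAr zu.
Qed.

(** For a norming functional f, the second ball forces f(1) = 1, and the first then gives f >= 0 on
    positive elements. *)
Lemma uc_pos_ball u : uc_pos u -> N u <= 1 ->
  N (1 - u) <= 1 /\ N (1 - (u + u)) <= 1.
Proof.
move=> pu u1; have [s [[ss _] s2 sc]] := uc_pos_sqrt pu.
have s1 : N s <= 1 by rewrite -(@expr_le1 _ 2) ?uc_norm_ge0 // -uc_norm_sa //
  s2.
have h1 : N (1 - u) <= 1 by rewrite -s2 uc_norm_one_sub_sqr.
split=> //.
have [r [r2 _ rr rc]] := uc_sqrt_one_sub u1; case: pu => su _.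
have {}rr := rr su; have rs : r * s = s * r by apply: sc; apply/esym/rc.
(* (r + is)^2 = (1 - 2u) + 2i rs, where r + is is unitary *)
pose x := r + 'i%C *: s.
have x1 : N x <= 1.
  rewrite -(@expr_le1 _ 2) ?uc_norm_ge0 // uc_norm_normal //.
  by rewrite r2 s2 subrK uc_norm1.
have x2 : x * x = (1 - (u + u)) + 'i%C *: (r * s + r * s).
  have ii : 'i%C * 'i%C = - 1 :> R[i] by rewrite -expr2 sqr_i.
  rewrite mulrDr !mulrDl -!scalerAl -!scalerAr scalerA ii scaleN1r -rs r2 s2.
  by rewrite scalerDr opprD !addrA [LHS]addrAC; congr (_ + _); rewrite addrAC.
have [||h _] := @uc_norm_cart _ _ (1 - (u + u)) (r * s + r * s).
- by rewrite uc_starB uc_starD uc_star1 su.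
- by rewrite uc_starD uc_starM ss rr -rs.
apply: le_trans h _; rewrite -x2; apply: le_trans (uc_normM _ _) _.
by rewrite mulr_ile1 ?uc_norm_ge0.
Qed.

(** The roots s of u and r of -u commute, so |r + is|^2 = |r^2 + s^2| = 0, which kills s. *)
Lemma uc_pos_antisym u : uc_pos u -> uc_pos (- u) -> u = 0.
Proof.
move=> pu pNu; have [s [[ss _] s2 sc]] := uc_pos_sqrt pu.
have [r [[rr _] r2 rc]] := uc_pos_sqrt pNu.
have rs : r * s = s * r.
  by apply: sc; apply: oppr_inj; rewrite -mulrN -mulNr; apply/esym/rc; rewrite
    mulrN mulNr.
have [_ ] := uc_norm_cart rr ss.
have -> : N (r + 'i%C *: s) = 0.
  by apply/eqP; rewrite -sqrf_eq0 uc_norm_normal // r2 s2 addNr uc_norm0.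
move=> s0; have /uc_norm_eq0 z : N s = 0 by apply/eqP; rewrite eq_le s0
  uc_norm_ge0.
by rewrite -s2 z mulr0.
Qed.

End UnitalCstarOrder.

(** * Positivity of squares *)

Section UnitalCstarSquares.
Variables (R : realType) (B : unital_cstar R).
Implicit Types (a b u v w x y z : B) (t : R).
Local Notation star := (@uc_star R B).
Local Notation N := (@uc_norm R B).

(** Only squares of self-adjoint elements are known to be positive so far; the symmetrized product
    is half the sum of two of them. *)
Lemma uc_pos_star_mul_add w : uc_pos (star w * w + w * star w).
Proof.
pose p := w + star w; pose q := 'i%C *: (w - star w).
have sp : star p = p by rewrite uc_starD uc_starK addrC.
have sq : star q = q by rewrite uc_star_i uc_starB uc_starK -scalerN opprB.
have ii : 'i%C * 'i%C = - 1 :> R[i] by rewrite -expr2 sqr_i.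
have -> : star w * w + w * star w = ((2^-1)%:C)%C *: (p * p + q * q).
  rewrite -scalerAl -scalerAr scalerA ii scaleN1r mulrBl !mulrBr !mulrDl
    !mulrDr.
  set ww := w * w; set ss := star w * star w.
  set ws := w * star w; set sw := star w * w.
  have -> : ww + ws + (sw + ss) - (ww - ws - (sw - ss)) = (sw + ws) + (sw + ws).
    have dbl a b : a + b + (b - a) = b + b by rewrite [a + b]addrC -addrA [a +
      _]addrC subrK.
    by rewrite !opprB [X in _ + X]addrC addrACA dbl [sw + ss]addrC dbl addrC
      addrACA.
  by rewrite fmorphV rmorph_nat half_double.
apply: uc_posZ; first by rewrite invr_ge0.
by apply: uc_posD; exact: uc_pos_sqr.
Qed.

(* Let u = v^* v, n = |u| - u, k = n |u|^(1/2) and w = v n, so that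
   w^* w = - k^2.  Then w2 = w k satisfies w2^* w2 = - k^4 and
   w2 w2^* = - (w w^* )^2, while the sum of these two is positive; hence
   k = 0, then n = 0, and u = |u|. *)
Lemma uc_pos_star_mul v : uc_pos (star v * v).
Proof.
set u := star v * v; have su : star u = u by exact: uc_star_mul_sa.
have [m [[sm pm] m2 mc]] := uc_pos_sqrt (uc_pos_sqr su).
have um : u * m = m * u by apply: mc; rewrite mulrA.
have [q [[sq _] q2 qc]] := uc_pos_sqrt (conj sm pm).
pose n := m - u; have sn : star n = n by rewrite uc_starB sm su.
have nm : n * m = m * n by rewrite mulrBl mulrBr um.
have nq : n * q = q * n by exact: qc.
have nu : n * u = - (m * n) by rewrite mulrBl mulrBr opprB m2.
pose k := n * q; have sk : star k = k by rewrite uc_starM sq sn -nq.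
have kk : k * k = m * n * n.
  by rewrite /k {2}nq mulrA -[n * q * q]mulrA q2 nm.
pose w := v * n.
have ww : star w * w = - (k * k).
  by rewrite uc_starM sn mulrA -[n * _ * v]mulrA nu mulNr kk.
pose w2 := w * k.
have w2l : star w2 * w2 = - ((k * k) * (k * k)).
  by rewrite /w2 uc_starM sk mulrA -[k * _ * w]mulrA ww mulrN mulNr !mulrA.
(* The extra factor [k] in [w2] gives this product a sign as well. This replaces the usual appeal to
   the common nonzero spectrum of [star w * w] and [w * star w]. *)
have w2r : w2 * star w2 = - ((w * star w) * (w * star w)).
  rewrite /w2 uc_starM sk mulrA -[w * k * k]mulrA -[k * k]opprK -ww.
  by rewrite mulrN mulNr !mulrA.
have skk : star (k * k) = k * k by rewrite uc_starM sk.
have /uc_sa_sqr_eq0 k4 : (k * k) * (k * k) = 0.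
  apply: uc_pos_antisym; first exact: uc_pos_sqr.
  have sww : star (w * star w) = w * star w by rewrite uc_starM uc_starK.
  rewrite -w2l -(addrK (w2 * star w2) (star w2 * w2)) w2r opprK -{1}w2r.
  exact: uc_posD (uc_pos_star_mul_add _) (uc_pos_sqr sww).
have k0 : k = 0 by apply: uc_sa_sqr_eq0 => //; exact: k4.
have nm0 : n * m = 0 by rewrite -q2 mulrA -/k k0 mul0r.
have n0 : n = 0.
  apply: uc_sa_sqr_eq0 => //.
  by rewrite {2}/n mulrBr nu -nm nm0 oppr0 subrr.
by have -> : u = m by apply/esym/eqP; rewrite -subr_eq0 -/n n0.
Qed.

End UnitalCstarSquares.

Lemma add1_sqr_lt (R : realFieldType) (t K : R) : 0 < t -> 0 <= K ->
  1 + t ^+ 2 * K < (1 + t * (t * (K + 1))) ^+ 2.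
Proof.
move=> t0 K0; have h := mulr_gt0 t0 t0.
have hK : 0 <= t * t * K by rewrite mulr_ge0 // ltW.
have := sqr_ge0 (t * (t * (K + 1))); rewrite !expr2 => h'; lra.
Qed.

(** * Contractive real functionals attaining their norm at a positive element *)

Section StatePositivity.
Variables (R : realType) (B : unital_cstar R) (f : B -> R).
Local Notation star := (@uc_star R B).
Local Notation N := (@uc_norm R B).
Hypothesis fD : forall a b, f (a + b) = f a + f b.
Hypothesis fZ : forall (t : R) a, f ((t%:C)%C *: a) = t * f a.
Hypothesis f_le : forall a, f a <= N a.
Variable c : B.
Hypotheses (pc : uc_pos c) (c0 : c != 0) (fc : f c = N c).

Let fN a : f (- a) = - f a.
Proof. by rewrite -scaleN1r -(rmorphN1 (real_complex R)) fZ mulN1r. Qed.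

(* ‖1 - 2c‖ <= 1 once c is normalized, so f (2c - 1) <= 1 forces f 1 >= 1. *)
Lemma norming_functional1 : f 1 = 1.
Proof.
apply/eqP; rewrite eq_le; have := f_le 1; rewrite uc_norm1 => -> /=.
have [t [y [t0 cE y1 sy]]] := uc_normalize c0.
have fy : f y = 1.
  apply: (mulfI (lt0r_neq0 t0)); rewrite -fZ -cE fc cE uc_norm_scale ?(ltW t0)
    //.
  by rewrite y1.
have py : uc_pos y.
  have -> : y = ((t^-1)%:C)%C *: c.
    by rewrite cE scalerA -rmorphM mulVf ?gt_eqF // rmorph1 scale1r.
  by apply: uc_posZ => //; rewrite invr_ge0 ltW.
have y1le : N y <= 1 by rewrite y1.
have [_ h] := uc_pos_ball py y1le.
have := f_le (- (1 - (y + y))); rewrite uc_normN fN !(fD, fN) fy.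
by move: h; set r := N _; move=> h h'; lra.
Qed.

(** If r = f(iu) were positive, then 1 + tr = f(1 + itu) <= |1 + itu| <= sqrt(1 + t^2 |u|^2) would
    hold for all real t, but for small t > 0 the linear term wins. *)
Let f_i_le0 u : star u = u -> f ('i%C *: u) <= 0.
Proof.
move=> su; set r := f _; rewrite leNgt; apply/negP => r0.
have key t : 1 + t * r <= Num.sqrt (1 + t ^+ 2 * N u ^+ 2).
  have /le_trans := f_le (1 + 'i%C *: ((t%:C)%C *: u)).
  rewrite fD norming_functional1 scalerA mulrC -scalerA fZ; apply.
  rewrite scalerA mulrC -scalerA -(ger0_norm (uc_norm_ge0 _)) -sqrtr_sqr.
  rewrite uc_norm_normal ?uc_star1 ?uc_starR ?su ?mulr1 ?mul1r //.
  rewrite ler_wsqrtr //; apply: le_trans (uc_normD _ _) _; rewrite uc_norm1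
    lerD2l.
  by rewrite uc_norm_sa ?uc_starR ?su // uc_normZ normcR exprMn real_normK //
    num_real.
pose K := N u ^+ 2; have K0 : 0 <= K by rewrite sqr_ge0.
(* This [t] makes r = t (K + 1), the form in which [add1_sqr_lt] contradicts [key]. *)
pose t := r / (K + 1); have K1 : 0 < K + 1 by rewrite ltr_wpDl.
have t0 : 0 < t by rewrite divr_gt0.
have rt : r = t * (K + 1) by rewrite /t divfK // gt_eqF.
have s0 : 0 <= 1 + t ^+ 2 * N u ^+ 2 by rewrite addr_ge0 // mulr_ge0 ?sqr_ge0.
have := key t; rewrite -(@ler_pXn2r _ 2) ?nnegrE ?sqrtr_ge0 //; last first.
  by rewrite addr_ge0 // mulr_ge0 // ltW.
by rewrite sqr_sqrtr // -/K rt leNgt add1_sqr_lt.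
Qed.

Lemma norming_functional_im u : star u = u -> f ('i%C *: u) = 0.
Proof.
move=> su; apply/eqP; rewrite eq_le f_i_le0 //= -oppr_le0 -fN -scalerN.
by rewrite f_i_le0 // uc_starN su.
Qed.

Lemma norming_functional_ge0 u : uc_pos u -> 0 <= f u.
Proof.
have [->|u0] := eqVneq u 0.
  by move=> _; rewrite -(subrr (0 : B)) fD fN subrr.
have [t [y [t0 uE y1 _]]] := uc_normalize u0 => pu.
have py : uc_pos y.
  have -> : y = ((t^-1)%:C)%C *: u.
    by rewrite uE scalerA -rmorphM mulVf ?gt_eqF // rmorph1 scale1r.
  by apply: uc_posZ => //; rewrite invr_ge0 ltW.
have y1le : N y <= 1 by rewrite y1.
have [h _] := uc_pos_ball py y1le.
rewrite uE fZ mulr_ge0 ?(ltW t0) //.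
by have := f_le (1 - y); rewrite fD fN norming_functional1; lra.
Qed.

End StatePositivity.

Section CstarTheory.
Variables (R : realType) (A : cstar_algebra R).
Implicit Types (a b c : A).
Local Notation star := (@ca_star R A).
Local Notation mul := (@ca_mul R A).
Local Notation N := (@ca_norm R A).

Lemma ca_mul0 a : mul a 0 = 0.
Proof. by rewrite -(scale0r (0 : A)) ca_mulZr !scale0r. Qed.

Lemma ca_0mul a : mul 0 a = 0.
Proof. by rewrite -(scale0r (0 : A)) ca_mulZl !scale0r. Qed.

Lemma ca_norm0 : N 0 = 0.
Proof. by rewrite -(scale0r (0 : A)) ca_normZ Normc.normc0 mul0r. Qed.

Lemma ca_normN a : N (- a) = N a.
Proof. by rewrite -scaleN1r ca_normZ normcN Normc.normc1 mul1r. Qed.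

Lemma ca_norm_ge0 a : 0 <= N a.
Proof.
have := ca_normD a (- a); rewrite subrr ca_norm0 ca_normN.
by rewrite -mulr2n pmulrn_lge0.
Qed.

Lemma ca_norm_scale (t : R) a : 0 <= t -> N ((t%:C)%C *: a) = t * N a.
Proof. by move=> t0; rewrite ca_normZ normcR_ge0. Qed.

Lemma ca_norm_star a : N (star a) = N a.
Proof.
suff le b : N b <= N (star b).
  by apply/eqP; rewrite eq_le le andbT -{2}[a]ca_starK le.
have [/eqP b0|b0] := boolP (N b == 0); first by rewrite b0 ca_norm_ge0.
have bp : 0 < N b by rewrite lt_neqAle eq_sym b0 ca_norm_ge0.
by rewrite -(ler_pM2r bp) -expr2 -ca_cstar ca_normM.
Qed.

Lemma ca_norm_gt0 a : a != 0 -> 0 < N a.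
Proof.
move=> a0; rewrite lt_neqAle ca_norm_ge0 eq_sym andbT.
by apply: contra a0 => /eqP/ca_norm_eq0 ->.
Qed.

End CstarTheory.

(** * Unitization *)

(** A pair (t, a) stands for t 1 + a, with a formal unit 1 even if A has one. *)
Definition unitization (R : realType) (A : cstar_algebra R) : Type :=
  (R[i]^o * A)%type.

HB.instance Definition _ (R : realType) (A : cstar_algebra R) :=
  GRing.Lmodule.copy (unitization A) (R[i]^o * A)%type.

Section UnitizationRing.
Variables (R : realType) (A : cstar_algebra R).
Implicit Types S T V : unitization A.

Definition uz_mul S T : unitization A :=
  (S.1 * T.1 : R[i], S.1 *: T.2 + T.1 *: S.2 + ca_mul S.2 T.2).
Definition uz_one : unitization A := (1 : R[i], 0).

Fact uz_mulA : associative uz_mul.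
Proof.
move=> [s a] [t b] [v c]; congr pair; rewrite /= ?mulrA //.
rewrite !(scalerDr, ca_mulDl, ca_mulDr, ca_mulZl, ca_mulZr, ca_mulA, scalerA).
rewrite [v * s]mulrC [v * t]mulrC !addrA; congr (_ + _); rewrite -!addrA.
by do 2!congr (_ + _); rewrite addrCA; congr (_ + _); rewrite addrA addrC.
Qed.

Fact uz_mul1 : left_id uz_one uz_mul.
Proof.
by move=> [s a]; congr pair; rewrite /= ?mul1r // ca_0mul scale1r scaler0
  !addr0.
Qed.

Fact uz_mulr1 : right_id uz_one uz_mul.
Proof.
by move=> [s a]; congr pair; rewrite /= ?mulr1 // ca_mul0 scale1r scaler0 add0r
  addr0.
Qed.

Fact uz_mulDl : left_distributive uz_mul +%R.
Proof.
move=> [s a] [t b] [v c]; congr pair; rewrite /= ?mulrDl //.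
by rewrite scalerDl scalerDr ca_mulDl [X in X + _ = _]addrACA [LHS]addrACA.
Qed.

Fact uz_mulDr : right_distributive uz_mul +%R.
Proof.
move=> [s a] [t b] [v c]; congr pair; rewrite /= ?mulrDr //.
by rewrite scalerDl scalerDr ca_mulDr [X in X + _ = _]addrACA [LHS]addrACA.
Qed.

Fact uz_one_neq0 : uz_one != 0.
Proof. by apply/eqP => -[] /eqP; rewrite oner_eq0. Qed.

HB.instance Definition _ := GRing.Zmodule_isNzRing.Build (unitization A)
  uz_mulA uz_mul1 uz_mulr1 uz_mulDl uz_mulDr uz_one_neq0.

Fact uz_scaleAl (k : R[i]) S T : k *: (S * T) = (k *: S) * T.
Proof.
case: S T => [s a] [t b]; congr pair => /=; first exact: mulrA.
by rewrite !scalerDr ca_mulZl !scalerA [t * k]mulrC.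
Qed.

HB.instance Definition _ :=
  GRing.Lmodule_isLalgebra.Build R[i] (unitization A) uz_scaleAl.

Fact uz_scaleAr (k : R[i]) S T : k *: (S * T) = S * (k *: T).
Proof.
case: S T => [s a] [t b]; congr pair => /=; first exact: mulrCA.
by rewrite !scalerDr ca_mulZr !scalerA [s * k]mulrC.
Qed.

HB.instance Definition _ :=
  GRing.Lalgebra_isAlgebra.Build R[i] (unitization A) uz_scaleAr.

End UnitizationRing.

Section UnitizationNorm.
Variables (R : realType) (A : cstar_algebra R).
Implicit Types (S T V : unitization A) (a z : A) (K : R).
Local Notation N := (@ca_norm R A).
Local Notation normc := (@Normc.normc R).

Definition uz_act T z : A := T.1 *: z + ca_mul T.2 z.

(* The bound on T.1 keeps this a norm even when A already has a unit, where
   the operator norm alone would be degenerate. *)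
Definition uz_bound T K := normc T.1 <= K /\ forall z, N (uz_act T z) <= K * N
  z.

(** This is the maximum of |T.1| and the operator norm of left multiplication by T on A. *)
Definition uz_norm T : R := inf [set K | uz_bound T K]%classic.

Definition uz_star T : unitization A := (Num.conj (T.1 : R[i]), ca_star T.2).

Lemma uz_actM S T z : uz_act (S * T) z = uz_act S (uz_act T z).
Proof.
case: S T => [s a] [t b]; rewrite /uz_act /=.
rewrite !(scalerDr, ca_mulDl, ca_mulDr, ca_mulZl, ca_mulZr, ca_mulA, scalerA).
by rewrite !addrA.
Qed.

Lemma uz_actD S T z : uz_act (S + T) z = uz_act S z + uz_act T z.
Proof.
by case: S T => [s a] [t b]; rewrite /uz_act /= scalerDl ca_mulDl addrACA.
Qed.

Lemma uz_actZ (k : R[i]) T z : uz_act (k *: T) z = k *: uz_act T z.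
Proof. by case: T => [t a]; rewrite /uz_act /= scalerDr scalerA ca_mulZl. Qed.

(** [uz_star T] acts as the adjoint of T for the A-valued inner product z^* w on A; this is the
    source of the C*-identity. *)
Lemma uz_act_star T z w :
  ca_mul (ca_star (uz_act T z)) w = ca_mul (ca_star z) (uz_act (uz_star T) w).
Proof.
case: T => [t a]; rewrite /uz_act /= ca_starD ca_starZ ca_starM.
by rewrite ca_mulDl ca_mulDr ca_mulZl ca_mulZr ca_mulA.
Qed.

Lemma uz_norm_le T K : uz_bound T K -> uz_norm T <= K.
Proof.
by move=> bK; apply: ge_inf => //; exists (normc T.1) => k [].
Qed.

Lemma uz_bound_add T : uz_bound T (normc T.1 + N T.2).
Proof.
split=> [|z]; first by rewrite lerDl ca_norm_ge0.
rewrite mulrDl -ca_normZ; apply: le_trans (ca_normD _ _) _.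
by rewrite lerD2l ca_normM.
Qed.

Lemma uz_norm_bound T : uz_bound T (uz_norm T).
Proof.
have ne : ([set K | uz_bound T K] !=set0)%classic.
  by exists (normc T.1 + N T.2); exact: uz_bound_add.
split=> [|z]; first by apply: lb_le_inf => // K [].
have [->|z0] := eqVneq z 0.
  by rewrite /uz_act scaler0 ca_mul0 addr0 ca_norm0 mulr0.
rewrite -ler_pdivrMr ?ca_norm_gt0 //; apply: lb_le_inf => // K [_ hK].
by rewrite ler_pdivrMr ?ca_norm_gt0.
Qed.

Lemma uz_norm_ge_scalar T : normc T.1 <= uz_norm T.
Proof. by case: (uz_norm_bound T). Qed.

Lemma uz_norm_act T z : N (uz_act T z) <= uz_norm T * N z.
Proof. by case: (uz_norm_bound T). Qed.

Lemma uz_norm_ge0 T : 0 <= uz_norm T.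
Proof. exact: le_trans (normc_ge0 _) (uz_norm_ge_scalar T). Qed.

(** The adjoint of a is a norming test vector, as |a a^*| = |a|^2; the scalar bound is harmless at
    0. *)
Lemma uz_norm_embed a : uz_norm ((0 : R[i]), a) = N a.
Proof.
apply/eqP; rewrite eq_le; apply/andP; split.
  apply: uz_norm_le; split=> [|z]; first by rewrite Normc.normc0 ca_norm_ge0.
  by rewrite /uz_act scale0r add0r ca_normM.
have [->|a0] := eqVneq a 0; first by rewrite ca_norm0 uz_norm_ge0.
have := uz_norm_act ((0 : R[i]), a) (ca_star a).
rewrite /uz_act scale0r add0r /= -{1}[a]ca_starK ca_cstar ca_norm_star expr2.
by rewrite ler_pM2r // ca_norm_gt0.
Qed.

Fact uz_starD S T : uz_star (S + T) = uz_star S + uz_star T.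
Proof. by congr pair; rewrite /= ?rmorphD ?ca_starD. Qed.

Fact uz_starZ (k : R[i]) T : uz_star (k *: T) = Num.conj k *: uz_star T.
Proof. by congr pair; rewrite /= ?ca_starZ //; exact: rmorphM. Qed.

Fact uz_starK T : uz_star (uz_star T) = T.
Proof. by case: T => [t a]; congr pair; rewrite /= ?ca_starK //; exact: conjcK.
  Qed.

Fact uz_starM S T : uz_star (S * T) = uz_star T * uz_star S.
Proof.
case: S T => [s a] [t b]; congr pair => /=.
  by rewrite mulrC; exact: rmorphM.
by rewrite !ca_starD !ca_starZ ca_starM [X in X + _]addrC.
Qed.

Fact uz_normD S T : uz_norm (S + T) <= uz_norm S + uz_norm T.
Proof.
apply: uz_norm_le; split=> [|z].
  apply: le_trans (lerD (uz_norm_ge_scalar S) (uz_norm_ge_scalar T)).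
  exact: normcD.
rewrite uz_actD mulrDl; apply: le_trans (ca_normD _ _) _.
by rewrite lerD ?uz_norm_act.
Qed.

Fact uz_normM S T : uz_norm (S * T) <= uz_norm S * uz_norm T.
Proof.
apply: uz_norm_le; split=> [|z].
  by rewrite Normc.normcM ler_pM ?normc_ge0 ?uz_norm_ge_scalar.
rewrite uz_actM; apply: le_trans (uz_norm_act _ _) _.
by rewrite -mulrA ler_wpM2l ?uz_norm_ge0 ?uz_norm_act.
Qed.

Fact uz_norm_eq0 T : uz_norm T = 0 -> T = 0.
Proof.
move=> T0; have := uz_norm_ge_scalar T; rewrite T0 => h.
have t0 : T.1 = 0.
  by apply: Normc.eq0_normc; apply/eqP; rewrite eq_le h normc_ge0.
case: T t0 T0 {h} => [t a] /= ->; rewrite uz_norm_embed.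
by move=> /ca_norm_eq0 ->.
Qed.

Fact uz_normZ (k : R[i]) T : uz_norm (k *: T) = normc k * uz_norm T.
Proof.
have le (l : R[i]) S : uz_norm (l *: S) <= normc l * uz_norm S.
  apply: uz_norm_le; split=> [|z].
    by rewrite Normc.normcM ler_wpM2l ?normc_ge0 ?uz_norm_ge_scalar.
  by rewrite uz_actZ ca_normZ -mulrA ler_wpM2l ?normc_ge0 ?uz_norm_act.
apply/eqP; rewrite eq_le le /=.
have [->|k0] := eqVneq k 0; first by rewrite Normc.normc0 mul0r uz_norm_ge0.
have nk : 0 < normc k.
  rewrite lt_neqAle normc_ge0 eq_sym andbT; apply: contra k0.
  by move=> /eqP/Normc.eq0_normc ->.
rewrite -ler_pdivlMl // -Normc.normcV.
by apply: le_trans (le _ _); rewrite scalerA mulVf ?scale1r.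
Qed.

(** From |Tz|^2 = |z^* (T^* T z)| <= |T^* T| |z|^2, the root of |T^* T| is a bound for T. Cancelling
    |T| yields |T| <= |T^*|, hence the converse inequality. *)
Fact uz_cstar T : uz_norm (uz_star T * T) = uz_norm T ^+ 2.
Proof.
have sq S : uz_norm S ^+ 2 <= uz_norm (uz_star S * S).
  set K := uz_norm (_ * _); have K0 : 0 <= K by exact: uz_norm_ge0.
  rewrite -[K]sqr_sqrtr // ler_pXn2r ?nnegrE ?uz_norm_ge0 ?sqrtr_ge0 //.
  apply: uz_norm_le; split=> [|z].
    rewrite -(ler_pXn2r (n := 2)) ?nnegrE ?normc_ge0 ?sqrtr_ge0 // sqr_sqrtr //.
    apply: le_trans (uz_norm_ge_scalar _).
    by rewrite Normc.normcM normc_conj expr2.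
  rewrite -(ler_pXn2r (n := 2)) ?nnegrE ?ca_norm_ge0 ?mulr_ge0 ?sqrtr_ge0
    ?ca_norm_ge0 //.
  rewrite exprMn sqr_sqrtr // -ca_cstar uz_act_star -uz_actM.
  apply: le_trans (ca_normM _ _) _; rewrite ca_norm_star mulrC expr2 mulrA.
  by rewrite ler_wpM2r ?ca_norm_ge0 ?uz_norm_act.
have star S : uz_norm S <= uz_norm (uz_star S).
  have [/eqP S0|S0] := boolP (uz_norm S == 0); first by rewrite S0 uz_norm_ge0.
  have Sp : 0 < uz_norm S by rewrite lt_neqAle eq_sym S0 uz_norm_ge0.
  by rewrite -(ler_pM2r Sp) -expr2; apply: le_trans (sq S) (uz_normM _ _).
apply/eqP; rewrite eq_le sq andbT; apply: le_trans (uz_normM _ _) _.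
by rewrite expr2 ler_wpM2r ?uz_norm_ge0 // -{2}[T]uz_starK star.
Qed.

End UnitizationNorm.

(** * Completeness of the unitization, one coordinate at a time *)

Section UnitizationComplete.
Variables (R : realType).

Lemma real_cauchy_converges (u : nat -> R) :
  cauchy_seq (fun x : R => `|x|) u -> exists l, converges_to (fun x : R =>
    `|x|) u l.
Proof.
(* The supremum of the numbers eventually below the sequence is its lower limit. *)
move=> cu; pose E := [set x : R | exists n, forall m, (n <= m)%N -> x <= u
  m]%classic.
have near eps : 0 < eps -> exists n, [/\ E (u n - eps), ubound E (u n + eps) &
    forall m, (n <= m)%N -> `|u m - u n| < eps].
  move=> /cu[n hn]; exists n; split=> [|x [m hm]|m nm]; last exact: hn.
  - by exists n => m nm; have := hn n m (leqnn n) nm; rewrite ltr_norml =>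
    /andP[]; lra.
  - have := hn n (maxn n m) (leqnn n) (leq_maxl n m).
    by have := hm _ (leq_maxr n m); rewrite ltr_norml => h /andP[]; lra.
have supE : has_sup E.
  by have [n [h1 h2 _]] := near 1 ltr01; split; [exists (u n - 1)|exists (u n +
    1)].
exists (sup E) => eps e0; have e20 : 0 < eps / 2 by rewrite divr_gt0.
have [n [h1 h2 h3]] := near (eps / 2) e20; exists n => m /h3.
have := sup_upper_bound supE h1; have := ge_sup (proj1 supE) h2.
by rewrite !ltr_norml => h4 h5 /andP[h6 h7]; apply/andP; split; lra.
Qed.

Lemma complex_cauchy_converges (u : nat -> R[i]) :
  cauchy_seq (@Normc.normc R) u -> exists l, converges_to (@Normc.normc R) u l.
Proof.
move=> cu.
have Re_le (k : R[i]) : `|complex.Re k| <= Normc.normc k.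
  by case: k => a b /=; rewrite -sqrtr_sqr ler_wsqrtr // lerDl sqr_ge0.
have Im_le (k : R[i]) : `|complex.Im k| <= Normc.normc k.
  by case: k => a b /=; rewrite -sqrtr_sqr ler_wsqrtr // lerDr sqr_ge0.
have ReB (k l : R[i]) : complex.Re (k - l) = complex.Re k - complex.Re l.
  by case: k l => ? ? [].
have ImB (k l : R[i]) : complex.Im (k - l) = complex.Im k - complex.Im l.
  by case: k l => ? ? [].
have [a ha] : exists l, converges_to (fun x : R => `|x|) (fun n => complex.Re
  (u n)) l.
  apply: real_cauchy_converges => eps /cu[n hn]; exists n => i j hi hj.
  by rewrite -ReB; apply: le_lt_trans (hn i j hi hj).
have [b hb] : exists l, converges_to (fun x : R => `|x|) (fun n => complex.Im
  (u n)) l.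
  apply: real_cauchy_converges => eps /cu[n hn]; exists n => i j hi hj.
  by rewrite -ImB; apply: le_lt_trans (hn i j hi hj).
exists (Complex a b) => eps e0; have e20 : 0 < eps / 2 by rewrite divr_gt0.
have [n hn] := ha _ e20; have [m hm] := hb _ e20.
exists (maxn n m) => i; rewrite geq_max => /andP[/hn h1 /hm h2].
case: (u i) h1 h2 => x y /= h1 h2.
apply: (@le_lt_trans _ _ (`|x - a| + `|y - b|)); last by lra.
rewrite -(@ler_pXn2r _ 2) ?nnegrE ?sqrtr_ge0 ?addr_ge0 // sqr_sqrtr ?addr_ge0
  ?sqr_ge0 //.
by rewrite [leRHS]sqrrD !real_normK ?num_real // addrAC lerDl mulrn_wge0 //
  mulr_ge0.
Qed.

Variable A : cstar_algebra R.
Local Notation normc := (@Normc.normc R).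

Lemma uz_norm_le_add (T : unitization A) : uz_norm T <= normc T.1 + ca_norm T.2.
Proof. exact: uz_norm_le (uz_bound_add T). Qed.

(** T.2 is T minus its scalar part, and each of the two has norm at most |T|. So Cauchy sequences
    are Cauchy in each coordinate. *)
Lemma ca_norm_le_uz (T : unitization A) : ca_norm T.2 <= 2 * uz_norm T.
Proof.
have -> : ca_norm T.2 = uz_norm (T - (T.1, 0)).
  rewrite -uz_norm_embed; congr uz_norm.
  by case: T => t a; congr pair; rewrite /= ?subrr ?subr0.
apply: le_trans (uz_normD _ _) _; rewrite mulr_natl mulr2n lerD2l.
apply: le_trans (uz_norm_le_add _) _.
by rewrite /= oppr0 ca_norm0 addr0 normcN uz_norm_ge_scalar.
Qed.

Fact uz_complete (u : nat -> unitization A) :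
  cauchy_seq (@uz_norm R A) u -> exists l, converges_to (@uz_norm R A) u l.
Proof.
move=> cu.
have [k hk] : exists k, converges_to normc (fun n => (u n).1) k.
  apply: complex_cauchy_converges => eps /cu[n hn]; exists n => i j hi hj.
  exact: le_lt_trans (uz_norm_ge_scalar (u i - u j)) (hn i j hi hj).
have [a ha] : exists a, converges_to (@ca_norm R A) (fun n => (u n).2) a.
  apply: ca_complete => eps e0; have e20 : 0 < eps / 2 by rewrite divr_gt0.
  have [n hn] := cu _ e20; exists n => i j hi hj.
  have := ca_norm_le_uz (u i - u j); have := hn i j hi hj.
  by move=> h h'; apply: le_lt_trans h' _; lra.
exists (k, a) => eps e0; have e20 : 0 < eps / 2 by rewrite divr_gt0.
have [n hn] := hk _ e20; have [m hm] := ha _ e20.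
exists (maxn n m) => i; rewrite geq_max => /andP[/hn h1 /hm h2].
by apply: le_lt_trans (uz_norm_le_add _) _; rewrite /=; lra.
Qed.

Definition unitization_cstar : unital_cstar R :=
  UnitalCstar (@uz_starD R A) (@uz_starZ R A) (@uz_starK R A) (@uz_starM R A)
    (@uz_norm_eq0 R A) (@uz_normD R A) (@uz_normZ R A) (@uz_normM R A)
    (@uz_cstar R A) uz_complete.

End UnitizationComplete.

(** * The Hahn-Banach theorem *)

Section HahnBanach.
Variables (R : realType) (V : lmodType R[i]).
Implicit Types (x y a : V) (p q : V -> R) (t r : R).

Definition sublinear q := (forall x y, q (x + y) <= q x + q y) /\
  (forall t x, 0 < t -> q ((t%:C)%C *: x) <= t * q x).

Lemma sublinear0 q : sublinear q -> q 0 = 0.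
Proof.
move=> [_ qZ]; have h12 : 0 < 2^-1 :> R by rewrite invr_gt0.
have := qZ _ 0 (@ltr0Sn R 1); have := qZ _ 0 h12.
by rewrite !scaler0 => h1 h2; apply/eqP; rewrite eq_le; apply/andP; split; lra.
Qed.

Lemma sublinear_ge q x : sublinear q -> - q (- x) <= q x.
Proof. by move=> sq; have := sq.1 x (- x); rewrite subrr sublinear0 //; lra.
  Qed.

(** [K k r] encodes the demand r <= f(k) on the functional to be found; such demands form a convex
    cone in V x R. *)
Definition subadd_cone (K : V -> R -> Prop) := [/\ K 0 0,
  (forall x r y s, K x r -> K y s -> K (x + y) (r + s)) &
  (forall t x r, 0 < t -> K x r -> K ((t%:C)%C *: x) (t * r))].

(** q' is the infimum over the cone of q(x + k) - r, finite because r <= q(k) bounds it below by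
    -q(-x). Taking x = -k gives q'(-k) <= -r, so every linear f <= q' meets the demands of [K]. *)
Lemma sublinear_cone_inf q K : sublinear q -> subadd_cone K ->
  (forall k r, K k r -> r <= q k) ->
  exists q', [/\ sublinear q', (forall x, q' x <= q x) &
    forall x k r, K k r -> q' x <= q (x + k) - r].
Proof.
move=> sq [K0 KD KZ] Kq; have [qD qZ] := sq.
pose S x := [set q (x + k.1) - k.2 | k in [set k : V * R | K k.1 k.2]]%classic.
have S0 x : (S x !=set0)%classic by exists (q (x + 0) - 0), (0, 0).
have Slb x : has_lbound (S x).
  exists (- q (- x)) => _ [[k r] /= Kkr <-].
  by have := qD (- x) (x + k); have := Kq _ _ Kkr; rewrite addKr; lra.
have infS x k r : K k r -> inf (S x) <= q (x + k) - r.
  by move=> Kkr; apply: ge_inf => //; exists (k, r).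
exists (fun x => inf (S x)); split=> //; last first.
  by move=> x; have := infS x _ _ K0; rewrite addr0 subr0.
split=> [x y|t x t0].
- rewrite -lerBlDr; apply: lb_le_inf => // _ [[k r] /= Kk <-].
  rewrite lerBlDr -lerBlDl; apply: lb_le_inf => // _ [[l s] /= Kl <-].
  have := infS (x + y) _ _ (KD _ _ _ _ Kk Kl).
  by rewrite addrACA; have := qD (x + k) (y + l); lra.
- rewrite -ler_pdivrMl //; apply: lb_le_inf => // _ [[k r] /= Kk <-].
  rewrite ler_pdivrMl // mulrBr; apply: le_trans (infS _ _ _ (KZ _ _ _ t0 Kk))
    _.
  by rewrite -scalerDr lerB // qZ.
Qed.

(* A minimal sublinear functional is linear: it coincides with each of the
   functionals x |-> inf_(t >= 0) (q (x + t a) - t q(a)). *)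
Lemma exists_linear_below p : sublinear p -> exists f,
  [/\ forall x y, f (x + y) = f x + f y,
      forall t x, f ((t%:C)%C *: x) = t * f x & forall x, f x <= p x].
Proof.
move=> sp; pose T := {q : V -> R | sublinear q /\ forall x, q x <= p x}.
(* The order is reversed, so that a maximal element for Zorn is a minimal sublinear functional. *)
pose le (q1 q2 : T) := `[< forall x, sval q2 x <= sval q1 x >].
have lex (q : T) : le q q by apply/asboolP.
have letr (q1 q2 q3 : T) : le q1 q2 -> le q2 q3 -> le q1 q3.
  move=> /asboolP h1 /asboolP h2; apply/asboolP => x.
  exact: le_trans (h2 x) (h1 x).
have lean (q1 q2 : T) : le q1 q2 -> le q2 q1 -> q1 = q2.
  move=> /asboolP h1 /asboolP h2; case: q1 q2 h1 h2 => q1 h1 [q2 h2] /= l1 l2.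
  have e : q1 = q2 by apply/funext => x; apply/eqP; rewrite eq_le l1 l2.
  by move: h1; rewrite e => h1; congr exist; exact: Prop_irrelevance.
pose mkT q (h : sublinear q /\ forall x, q x <= p x) : T := exist _ q h.
pose p' := mkT p (conj sp (fun x => lexx (p x))).
have chain (C : set T) : total_on C le -> exists q : T, forall s, C s -> le s q.
  (* Adjoining [p'] keeps the pointwise infimum over a nonempty family when the chain is empty. *)
  move=> Ctot; pose D := [set q : T | C q \/ q = p']%classic.
  have Dp : D p' by right.
  have Dtot (q1 q2 : T) : D q1 -> D q2 -> exists q : T, [/\ D q, le q1 q & le
    q2 q].
    have lep (q : T) : le p' q by apply/asboolP => x; case: (svalP q).
    move=> [C1|->] [C2|->].
    - by have [h|h] := Ctot _ _ C1 C2; [exists q2|exists q1]; split=> //; left.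
    - by exists q1; split=> //; left.
    - by exists q2; split=> //; left.
    - by exists p'.
  pose S x := [set sval (q : T) x | q in D]%classic.
  have S0 x : (S x !=set0)%classic by exists (p x), p'.
  have Slb x : has_lbound (S x).
    exists (- p (- x)) => _ [q _ <-]; have [sq qp] := svalP q.
    by have := sublinear_ge x sq; have := qp (- x); lra.
  have infS x (q : T) : D q -> inf (S x) <= sval q x.
    by move=> Dq; apply: ge_inf => //; exists q.
  have sub : sublinear (fun x => inf (S x)).
    split=> [x y|t x t0].
    - rewrite -lerBlDr; apply: lb_le_inf => // _ [q1 D1 <-].
      rewrite lerBlDr -lerBlDl; apply: lb_le_inf => // _ [q2 D2 <-].
      have [q [Dq /asboolP h1 /asboolP h2]] := Dtot _ _ D1 D2.
      have [[qD _] _] := svalP q; have := infS (x + y) _ Dq.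
      by have := qD x y; have := h1 x; have := h2 y; lra.
    - rewrite -ler_pdivrMl //; apply: lb_le_inf => // _ [q Dq <-].
      rewrite ler_pdivrMl //; apply: le_trans (infS _ _ Dq) _.
      by have [[_ qZ] _] := svalP q; apply: qZ.
  have subp : sublinear (fun x => inf (S x)) /\ forall x, inf (S x) <= p x.
    by split=> // x; exact: infS Dp.
  exists (mkT _ subp) => q Cq.
  by apply/asboolP => x; apply: infS; left.
have [[q [sq qp]] qmin] := Zorn lex letr lean chain.
have [qD qZ] := sq.
have qZe t x : 0 < t -> q ((t%:C)%C *: x) = t * q x.
  move=> t0; apply/eqP; rewrite eq_le qZ //= -ler_pdivlMl //.
  have ti0 : 0 < t^-1 by rewrite invr_gt0.
  apply: le_trans (qZ _ _ ti0).
  by rewrite scalerA -rmorphM mulVf ?gt_eqF // rmorph1 scale1r.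
have qDe x a : q (x + a) = q x + q a.
  apply/eqP; rewrite eq_le qD /=.
  pose K (y : V) (r : R) := exists2 t, 0 <= t & y = (t%:C)%C *: a /\ r = t * q
    a.
  have [||q' [sq' q'q q'K]] := @sublinear_cone_inf q K sq.
  - split; first by exists 0; rewrite // scale0r mul0r.
    + move=> ? ? ? ? [t t0 [-> ->]] [s s0 [-> ->]]; exists (t + s); first
      exact: addr_ge0.
      by rewrite rmorphD scalerDl mulrDl.
    + move=> s ? ? s0 [t t0 [-> ->]]; exists (s * t); first by rewrite mulr_ge0
      // ltW.
      by rewrite rmorphM scalerA mulrA.
  - move=> k r [t]; rewrite le_eqVlt => /predU1P[<-|t0] [-> ->].
      by rewrite scale0r sublinear0 ?mul0r.
    by rewrite qZe.
  have q'p : sublinear q' /\ forall x, q' x <= p x.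
    by split=> // y; apply: le_trans (q'q y) (qp y).
  have /(congr1 sval)/= e : mkT q (conj sq qp) = mkT q' q'p.
    by apply/esym/qmin/asboolP.
  have Ka : K a (q a) by exists 1; rewrite ?scale1r ?mul1r.
  by have := q'K x _ _ Ka; rewrite -e; lra.
exists q; split=> // t x; have [t0|t0|->] := ltgtP t 0; last 1 first.
- by rewrite scale0r mul0r sublinear0.
- have e : q ((t%:C)%C *: x) + q (((- t)%:C)%C *: x) = 0.
    by rewrite -qDe -scalerDl -rmorphD subrr scale0r sublinear0.
  by move: e; rewrite [X in _ + X]qZe ?oppr_gt0 //; lra.
- exact: qZe.
Qed.

(* The Mazur-Orlicz form of the Hahn-Banach theorem. *)
Theorem hahn_banach_cone p K : sublinear p -> subadd_cone K ->
  (forall k r, K k r -> r <= p k) -> exists f,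
  [/\ forall x y, f (x + y) = f x + f y,
      forall t x, f ((t%:C)%C *: x) = t * f x, forall x, f x <= p x &
      forall k r, K k r -> r <= f k].
Proof.
move=> sp Kc Kp; have [q [sq qp qK]] := sublinear_cone_inf sp Kc Kp.
have [f [fD fZ fq]] := exists_linear_below sq; exists f; split=> // [x|k r Kkr].
  exact: le_trans (fq x) (qp x).
have f0 : f 0 = 0 by rewrite -(scale0r (0 : V)) (fZ 0) mul0r.
have := qK (- k) _ _ Kkr; have := fq (- k); have := fD k (- k).
by rewrite subrr f0 addNr sublinear0 //; lra.
Qed.

End HahnBanach.

(** * From a norming real functional to a state *)

Section NormingState.
Variables (R : realType) (A : cstar_algebra R).
Local Notation N := (@ca_norm R A).
Local Notation B := (unitization_cstar A).
Local Notation iota := (fun a : A => ((0 : R[i]), a) : B).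

Let iotaD (a b : A) : iota (a + b) = iota a + iota b.
Proof. by congr pair; rewrite /= ?addr0. Qed.

Let iotaZ (k : R[i]) (a : A) : iota (k *: a) = k *: iota a.
Proof. by congr pair; exact/esym/mulr0. Qed.

Let iota_star_mul (a : A) :
  iota (ca_mul (ca_star a) a) = uc_star (iota a) * iota a.
Proof.
congr pair; first by rewrite /= mulr0.
by rewrite /= rmorph0 !scale0r !add0r.
Qed.

Lemma exists_norming_state (c b : A) : ca_pos c -> c != 0 ->
  (forall k : R[i], N c <= N (c + k *: b)) ->
  exists phi : A -> R[i],
    [/\ is_state phi, phi c = ((N c)%:C)%C & phi b = 0].
Proof.
move=> pc c0 orth; have Nc0 := ca_norm_gt0 c0.
(* The cone demands f(c) >= |c| and f(l b) >= 0 for every complex l. Replacing l by -l turns the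
   latter into f(l b) = 0, and compatibility with the norm is the hypothesis [orth] rescaled by
   t. *)
pose K (k : B) (r : R) := exists t l,
  [/\ 0 <= t, k = (t%:C)%C *: iota c + l *: iota b & r = t * N c].
have sp : sublinear (@uc_norm R B).
  by split=> [|t x t0]; [exact: uc_normD|rewrite uc_norm_scale // ltW].
have Kc : subadd_cone K.
  split.
  - by exists 0, 0; rewrite !scale0r addr0 mul0r.
  - move=> _ _ _ _ [t [l [t0 -> ->]]] [t' [l' [t0' -> ->]]].
    exists (t + t'), (l + l'); split; rewrite ?addr_ge0 ?mulrDl //.
    by rewrite rmorphD !scalerDl addrACA.
  - move=> s _ _ s0 [t [l [t0 -> ->]]]; exists (s * t), ((s%:C)%C * l).
    by split; rewrite ?mulr_ge0 ?(ltW s0) ?mulrA // scalerDr !scalerA rmorphM.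
have Kp k r : K k r -> r <= uc_norm k.
  move=> [t [l [t0 -> ->]]]; rewrite -!iotaZ -iotaD /= uz_norm_embed.
  move: t0; rewrite le_eqVlt => /predU1P[<-|t0]; first by rewrite mul0r
    ca_norm_ge0.
  have -> : (t%:C)%C *: c + l *: b = (t%:C)%C *: (c + ((t^-1)%:C)%C * l *: b).
    by rewrite scalerDr !scalerA mulrA -rmorphM mulfV ?gt_eqF // rmorph1 mul1r.
  by rewrite ca_norm_scale ?(ltW t0) // ler_pM2l.
have [f [fD fZ f_le fK]] := hahn_banach_cone sp Kc Kp.
have fN a : f (- a) = - f a.
  by rewrite -scaleN1r -(rmorphN1 (real_complex R)) fZ mulN1r.
have fi a : f ('i%C *: ('i%C *: a)) = - f a.
  by rewrite scalerA -expr2 sqr_i scaleN1r.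
have fc : f (iota c) = N c.
  apply/eqP; rewrite eq_le -{1}uz_norm_embed f_le fK //.
  by exists 1, 0; rewrite scale0r addr0 scale1r mul1r.
have fb k : f (k *: iota b) = 0.
  have ge0 l : 0 <= f (l *: iota b).
    by apply: fK; exists 0, l; rewrite scale0r add0r mul0r.
  by apply/eqP; rewrite eq_le ge0 andbT -oppr_ge0 -fN -scaleNr ge0.
have [v cE] := pc; have pic : uc_pos (iota c).
  by rewrite cE iota_star_mul; exact: uc_pos_star_mul.
have ic0 : iota c != 0 by apply: contra c0 => /eqP[->].
have fc' : f (iota c) = uc_norm (iota c) by rewrite fc /= uz_norm_embed.
(* The complex-linear functional with real part f; it is real on self-adjoint elements because f
   vanishes on i times them. *)
pose phi (a : A) : R[i] := Complex (f (iota a)) (- f ('i%C *: iota a)).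
have phi_c : phi c = ((N c)%:C)%C.
  rewrite /phi fc (norming_functional_im fD fZ f_le pic ic0 fc') ?oppr0 //.
  by case: pic.
have phi0 : phi 0 = 0.
  have f0 : f 0 = 0 by rewrite -(scale0r (0 : B)) (fZ 0) mul0r.
  by rewrite /phi -[iota 0]/(0 : B) scaler0 f0 oppr0.
have phi_lin (k : R[i]) (a d : A) : phi (k *: a + d) = k * phi a + phi d.
  case: k => s t; rewrite /phi iotaD iotaZ.
  have -> : Complex s t = (s%:C)%C + (t%:C)%C * 'i%C by rewrite [LHS]complexE
    [in LHS]mulrC.
  set x := iota a; set y := iota d.
  rewrite scalerDr fD fD !scalerDl scalerDr !fD -!scalerA fZ fZ.
  rewrite (scalerA 'i%C) (scalerA 'i%C (t%:C)%C) ![in 'i%C * _]mulrC -!scalerA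
    !fZ fi.
  by apply/eqP; rewrite eq_complex /=; apply/andP; split; apply/eqP; ring.
exists phi; split=> //; last first.
  rewrite /phi fb oppr0 -(scale1r (iota b)) fb //.
split=> //.
- move=> _ [a ->]; rewrite /phi iota_star_mul.
  have pa := uc_pos_star_mul (iota a).
  rewrite (norming_functional_im fD fZ f_le pic ic0 fc') ?oppr0 ?ler0c; last by
    case: pa.
  exact: (norming_functional_ge0 fD fZ f_le pic ic0 fc').
- move=> a; set r := Normc.normc _.
  have [->|r0] := eqVneq r 0; first exact: ca_norm_ge0.
  have rp : 0 < r by rewrite lt_neqAle eq_sym r0 normc_ge0.
  (* Rotating by [k] makes the value real: |phi a|^2 = phi(k a) = f(k a) <= |phi a| |a|. *)
  rewrite -(ler_pM2l rp); pose k := Num.conj (phi a).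
  have <- : Normc.normc k = r by exact: normc_conj.
  rewrite -ca_normZ -uz_norm_embed; apply: le_trans (f_le _).
  have -> : f (iota (k *: a)) = complex.Re (phi (k *: a + 0)) by rewrite addr0.
  rewrite phi_lin normc_conj -/r.
  rewrite phi0 addr0 /k /r; case: (phi a) => x y /=.
  by rewrite -expr2 sqr_sqrtr ?addr_ge0 ?sqr_ge0 // !expr2 mulNr opprK.
- move=> eps e0; exists (((N c)^-1%:C)%C *: c).
  have Ninv : 0 <= (N c)^-1 by rewrite invr_ge0 ltW.
  rewrite ca_norm_scale // mulVf ?gt_eqF //; split=> //.
  have -> : phi (((N c)^-1%:C)%C *: c) = 1.
    by rewrite -[X in phi X]addr0 phi_lin phi0 addr0 phi_c -rmorphM mulVf
      ?gt_eqF // rmorph1.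
  by rewrite Normc.normc1 gtrBl.
Qed.

End NormingState.

(** * Hilbert modules *)

Section HilbertModule.
Variables (R : realType) (A : cstar_algebra R) (X : hilbert_module A).
Implicit Types (x y : X) (k : R[i]).
Local Notation N := (@ca_norm R A).
Local Notation star := (@ca_star R A).

Lemma hm_normE x : hm_norm x ^+ 2 = N (hm_ip x x).
Proof. by rewrite sqr_sqrtr // ca_norm_ge0. Qed.

Lemma hm_ipDr x y z : hm_ip x (y + z) = hm_ip x y + hm_ip x z.
Proof. by have := hm_ip_lin 1 x y z; rewrite !scale1r. Qed.

Lemma hm_ip0r x : hm_ip x 0 = 0.
Proof. by apply: (addIr (hm_ip x 0)); rewrite -hm_ipDr !add0r. Qed.

Lemma hm_ipZr k x y : hm_ip x (k *: y) = k *: hm_ip x y.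
Proof. by have := hm_ip_lin k x y 0; rewrite !addr0 hm_ip0r addr0. Qed.

Lemma hm_ipDl x y z : hm_ip (x + y) z = hm_ip x z + hm_ip y z.
Proof. by rewrite -hm_ip_star hm_ipDr ca_starD !hm_ip_star. Qed.

Lemma hm_ipZl k x y : hm_ip (k *: x) y = Num.conj k *: hm_ip x y.
Proof. by rewrite -hm_ip_star hm_ipZr ca_starZ hm_ip_star. Qed.

Lemma hm_ip_perturb x y k :
  hm_ip (x + k *: y) (x + k *: y) = hm_ip x x + k *: hm_ip x y
    + Num.conj k *: hm_ip y x + (Num.conj k * k) *: hm_ip y y.
Proof.
by rewrite hm_ipDl !hm_ipDr !hm_ipZl !hm_ipZr scalerA addrA.
Qed.

Lemma conj_mul_self k : Num.conj k * k = ((Normc.normc k ^+ 2)%:C)%C.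
Proof.
case: k => a b; rewrite /= sqr_sqrtr ?addr_ge0 ?sqr_ge0 //.
by apply/eqP; rewrite eq_complex /= !expr2; apply/andP; split; apply/eqP; ring.
Qed.

(** To first order in s, <x + s y, x + s y> is the real part of c + 2 s b, whose norm is at most
    that of c + 2 s b. The second-order error disappears after dividing by the step size. *)
Lemma birkhoff_orth_ip x y : birkhoff_orth x y ->
  forall k, N (hm_ip x x) <= N (hm_ip x x + k *: hm_ip x y).
Proof.
move=> orth k; set c := hm_ip x x; set b := hm_ip x y.
pose D := Normc.normc k ^+ 2 * N (hm_ip y y).
have D0 : 0 <= D by rewrite mulr_ge0 ?sqr_ge0 ?ca_norm_ge0.
have key t : 0 < t -> N c <= N (c + ((t%:C)%C * k) *: b) + t ^+ 2 * D.
  (* The factor 1/2 makes the first-order part exactly the average of d = c + t k b and its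
     adjoint. *)
  move=> t0; pose s : R[i] := 2^-1 * ((t%:C)%C * k).
  have h : N c <= N (hm_ip (x + s *: y) (x + s *: y)).
    by rewrite -!hm_normE ler_pXn2r ?nnegrE ?sqrtr_ge0.
  apply: le_trans h _; rewrite hm_ip_perturb -/c -/b.
  apply: le_trans (ca_normD _ _) _; apply: lerD.
    set d := c + (_ * k) *: b.
    have -> : c + s *: b + Num.conj s *: hm_ip y x = 2^-1 *: (d + star d).
      rewrite ca_starD ca_starZ !hm_ip_star addrACA !scalerDr -scalerDr.
      rewrite half_double !scalerA addrA; congr (_ + _ *: _).
      by rewrite /s rmorphM fmorphV rmorph_nat.
    rewrite ca_normZ normc_half; have := ca_normD d (star d).
    by rewrite ca_norm_star; lra.
  rewrite ca_normZ conj_mul_self normcR_ge0 ?sqr_ge0 // /D mulrA -exprMn.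
  rewrite ler_wpM2r ?ca_norm_ge0 // ler_pXn2r ?nnegrE ?normc_ge0 ?mulr_ge0
    ?normc_ge0 ?(ltW t0) //.
  rewrite /s !Normc.normcM normc_half normcR_ge0 ?(ltW t0) //.
  have := normc_ge0 k; have tk : 0 <= t * Normc.normc k by rewrite mulr_ge0
    ?normc_ge0 ?ltW.
  lra.
(* By convexity, N (c + t k b) <= (1 - t) N c + t N (c + k b). *)
apply/ler_addgt0Pr => e e0; pose t := Num.min 1 (e / (D + 1)).
have D1 : 0 < D + 1 by rewrite ltr_wpDl.
have t0 : 0 < t by rewrite lt_min ltr01 divr_gt0.
have t1 : t <= 1 by rewrite ge_min lexx.
(* [t] was capped by 1 for the convex combination; the + 1 in its denominator covers D = 0. *)
have tD : t * D <= e.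
  apply: le_trans (_ : e / (D + 1) * (D + 1) <= e); last by rewrite divfK
    ?gt_eqF.
  apply: ler_pM => //; [exact: ltW|by rewrite ge_min lexx orbT|by rewrite
    lerDl].
have := key t t0.
have -> : c + ((t%:C)%C * k) *: b = ((1 - t)%:C)%C *: c + (t%:C)%C *: (c + k *:
  b).
  by rewrite scalerDr addrA -scalerDl -rmorphD subrK rmorph1 scale1r scalerA.
move=> h; have := ca_normD (((1 - t)%:C)%C *: c) ((t%:C)%C *: (c + k *: b)).
rewrite !ca_norm_scale ?subr_ge0 ?(ltW t0) // => h'.
rewrite -(ler_pM2l t0); have := ler_wpM2l (ltW t0) tD.
by move: h h'; rewrite expr2; lra.
Qed.

End HilbertModule.

Section States.
Variables (R : realType) (A : cstar_algebra R) (X : hilbert_module A).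
Implicit Types (x y : X) (k : R[i]) (phi : A -> R[i]).

Lemma mval_le_state phi y :
  is_state phi -> mval y <= complex.Re (phi (hm_ip y y)).
Proof.
move=> sphi; apply: ge_inf; last by exists phi.
exists 0 => _ [psi [_ psi_pos _ _] <-].
by have := psi_pos _ (hm_ip_pos y); rewrite lecE => /andP[].
Qed.

Lemma mval_ge0 y : 0 <= mval y.
Proof.
rewrite /mval; set E := image _ _.
have [ne|] := pselect (E !=set0)%classic.
  apply: lb_le_inf => // _ [psi [_ psi_pos _ _] <-].
  by have := psi_pos _ (hm_ip_pos y); rewrite lecE => /andP[].
(* Without any state the infimum takes its default value 0. *)
by move=> /set0P/negP; rewrite negbK => /eqP ->; rewrite inf0.
Qed.

(** [is_state] does not list compatibility with adjoints, so the vanishing at <y,x> is drawn from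
    positivity of phi on inner squares. *)
Lemma state_perturb phi x y k : is_state phi -> phi (hm_ip x y) = 0 ->
  phi (hm_ip (x + k *: y) (x + k *: y)) =
    phi (hm_ip x x) + ((Normc.normc k ^+ 2)%:C)%C * phi (hm_ip y y).
Proof.
move=> [phi_lin phi_pos _ _] phi_xy.
have phiD a b : phi (a + b) = phi a + phi b.
  by rewrite -[a]scale1r phi_lin mul1r !scale1r.
have phi0 : phi 0 = 0 by apply: (addIr (phi 0)); rewrite -phiD !add0r.
have phiZ l a : phi (l *: a) = l * phi a.
  by rewrite -[l *: a]addr0 phi_lin phi0 addr0.
have im0 (z : X) : complex.Im (phi (hm_ip z z)) = 0.
  by apply: ger0_Im; exact/phi_pos/hm_ip_pos.
have E l : phi (hm_ip (x + l *: y) (x + l *: y)) =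
    phi (hm_ip x x) + Num.conj l * phi (hm_ip y x) +
    ((Normc.normc l ^+ 2)%:C)%C * phi (hm_ip y y).
  by rewrite hm_ip_perturb !phiD !phiZ phi_xy mulr0 addr0 conj_mul_self.
rewrite E; suff -> : phi (hm_ip y x) = 0 by rewrite mulr0 addr0.
(* phi <x + l y, x + l y> is real for l = 1 and for l = i. *)
have := im0 (x + 1 *: y); have := im0 (x + 'i%C *: y); rewrite !E.
have := im0 x; have := im0 y.
case: (phi (hm_ip x x)) (phi (hm_ip y x)) (phi (hm_ip y y)) => [a a'] [b b'] [d
  d'].
rewrite /= => -> ->; rewrite !(mulr0, mul0r, add0r, addr0, mul1r, subr0, oppr0,
  mulN1r, sub0r).
move=> h1 h2; apply/eqP; rewrite eq_complex /=; apply/andP; split; apply/eqP;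
  lra.
Qed.

End States.

Theorem theorem3p2 (R : realType) (A : cstar_algebra R) (X : hilbert_module A) (x y : X)
  (nontriv : exists a : A, a != 0) :
  [<-> birkhoff_orth x y;
       exists2 phi : A -> R[i], Omega x phi & phi (hm_ip x y) = 0;
       forall lam : R[i],
         hm_norm x ^+ 2 + Normc.normc lam ^+ 2 * mval y <= hm_norm (x + lam *: y) ^+ 2].
Proof.
tfae.
- move=> orth; have [x0|c0] := eqVneq (hm_ip x x) 0.
    (* For x = 0 any state will do; one is obtained by norming a nonzero square, with b = 0. *)
    have [a a0] := nontriv; pose c := ca_mul (ca_star a) a.
    have c0 : c != 0.
      apply/eqP => c0; move/eqP: a0; apply; apply: ca_norm_eq0; apply/eqP.
      by rewrite -sqrf_eq0 -ca_cstar -/c c0 ca_norm0.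
    have [||phi [sphi _ _]] := @exists_norming_state _ _ c 0 _ c0.
    + by exists a.
    + by move=> k; rewrite scaler0 addr0.
    have [phi_lin _ _ _] := sphi.
    have phi0 : phi 0 = 0.
      by have := phi_lin (-1) 0 0; rewrite scaler0 addr0 mulN1r addNr.
    exists phi; first by split; rewrite // hm_normE x0 phi0 ca_norm0.
    by rewrite (hm_ip_eq0 x0) -hm_ip_star hm_ip0r -(scale0r (0 : A)) ca_starZ
      rmorph0 scale0r.
  have [phi [sphi phic phib]] :=
    exists_norming_state (hm_ip_pos x) c0 (birkhoff_orth_ip orth).
  by exists phi => //; split; rewrite // hm_normE.
- move=> [phi [sphi phix] phi_xy] lam.
  have [_ _ phi_le _] := sphi; rewrite [leRHS]hm_normE.
  (* Contractivity of phi bounds |x + lam y|^2 below by the real part of phi at the inner square,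
     where the cross terms vanish. *)
  apply: le_trans (phi_le _); apply: le_trans (ler_normc_Re _).
  rewrite (state_perturb _ sphi phi_xy) phix.
  have -> : complex.Re (((hm_norm x ^+ 2)%:C)%C +
      ((Normc.normc lam ^+ 2)%:C)%C * phi (hm_ip y y)) =
      hm_norm x ^+ 2 + Normc.normc lam ^+ 2 * complex.Re (phi (hm_ip y y)).
    by case: (phi _) => a b /=; rewrite mul0r subr0.
  by rewrite lerD2l ler_wpM2l ?sqr_ge0 // mval_le_state.
- move=> h lam; rewrite -(ler_pXn2r (n := 2)) ?nnegrE ?sqrtr_ge0 //.
  apply: le_trans (h lam); rewrite lerDl mulr_ge0 ?sqr_ge0 //.
  exact: mval_ge0.
Qed.
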